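(* Every unital completely positive map $T\colon M_2\to M_2$ has an invariant masa, i.e. there is a maximal abelian subalgebra $\mathcal{C}\subset M_2$ with $T(\mathcal{C})\subset\mathcal{C}$. Every generator $L$ of a Markov semigroup on $M_2$ has an invariant masa, i.e. there is a maximal abelian subalgebra $\mathcal{C}\subset M_2$ with $L(\mathcal{C})\subset\mathcal{C}$.
   Context: $M_2$ is the von Neumann algebra of complex $2\times2$ matrices. A Markov semigroup on $M_2$ is a (norm-)continuous one-parameter semigroup $T_t=e^{tL}$ $(t\ge0)$ of unital completely positive maps on $M_2$, with generator $L$. A maximal abelian subalgebra (masa) of $M_2$ is a commutative $*$-subalgebra containing $\mathbf{1}$ and not properly contained in another commutative $*$-subalgebra. *)

(* Defs.v *)
From HB Require Import structures.
From mathcomp Require Import all_boot all_order all_algebra.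
From mathcomp Require Import all_classical all_reals all_analysis.
From mathcomp Require Import complex.

Set Implicit Arguments.
Unset Strict Implicit.
Unset Printing Implicit Defensive.

Import Order.TTheory GRing.Theory Num.Theory.
Import numFieldNormedType.Exports.

Local Open Scope classical_set_scope.
Local Open Scope sesquilinear_scope.
Local Open Scope complex_scope.
Local Open Scope ring_scope.

(* The norm topology of the complex numbers R[i]; the topology of the matrix
   spaces over R[i] is inferred from it. *)
HB.instance Definition _ (R : realType) :=
  NormedModule.copy R[i] (R[i] : numFieldType)^o.

Notation M2 R := 'M[R[i]]_2.

Section Definitions.
Variable R : realType.

(* Commutative *-subalgebras; the unit is not required here. *)
Record comm_star_subalgebra (C : set (M2 R)) : Prop := CommStarSubalgebra {
  css_zero : C 0;
  css_add : forall a b, C a -> C b -> C (a + b);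
  css_scale : forall (z : R[i]) a, C a -> C (z *: a);
  css_mul : forall a b, C a -> C b -> C (a *m b);
  css_adj : forall a, C a -> C (a ^t*);
  css_comm : forall a b, C a -> C b -> a *m b = b *m a }.

Definition masa (C : set (M2 R)) : Prop :=
  [/\ comm_star_subalgebra C, C 1%:M
    & forall D, comm_star_subalgebra D -> C `<=` D -> D = C].

(* The involution of M_n(M_2): transpose, and take the adjoint of every
   entry. *)
Definition adjM n (B : 'M[M2 R]_n) : 'M[M2 R]_n :=
  map_mx (fun a : M2 R => a ^t*) B^T.

(* Positivity in the C*-algebra M_n(M_2). *)
Definition positiveM n (A : 'M[M2 R]_n) : Prop :=
  exists B : 'M[M2 R]_n, A = adjM B *m B.

(* [map_mx T] is the amplification of T to M_n(M_2). *)
Definition completely_positive (T : M2 R -> M2 R) : Prop :=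
  forall n (A : 'M[M2 R]_n), positiveM A -> positiveM (map_mx T A).

Definition ucp (T : {linear M2 R -> M2 R}) : Prop :=
  T 1%:M = 1%:M /\ completely_positive T.

(* [lin_mx S] is the 4 x 4 matrix of the linear operator S on M_2. As all norms
   on the finite-dimensional space of these operators are equivalent,
   convergence and continuity in operator norm are those of [lin_mx S].
   [lin_mx] reverses composition, which is harmless for the powers of L. *)
Definition is_exp_semigroup (T : R -> {linear M2 R -> M2 R})
    (L : {linear M2 R -> M2 R}) : Prop :=
  forall t, 0 <= t ->
    series (fun k => (exp_coeff t k)%:C *: lin_mx L ^+ k) @ \oo
      --> lin_mx (T t).

(* Only the values T t with 0 <= t matter. *)
Record markov_semigroup (T : R -> {linear M2 R -> M2 R})
    (L : {linear M2 R -> M2 R}) : Prop := MarkovSemigroup {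
  ms_ucp : forall t, 0 <= t -> ucp (T t);
  ms_zero : forall a, T 0 a = a;
  ms_add : forall s t, 0 <= s -> 0 <= t -> forall a, T (s + t) a = T s (T t a);
  ms_cont : {within `[0, +oo[, continuous (fun t => lin_mx (T t))};
  ms_exp : is_exp_semigroup T L }.

Definition markov_generator (L : {linear M2 R -> M2 R}) : Prop :=
  exists T, markov_semigroup T L.

End Definitions.

(* Main.v *)
From HB Require Import structures.
Require Import Defs.
From mathcomp Require Import all_boot all_order all_algebra.
From mathcomp Require Import all_classical all_reals all_analysis.
From mathcomp Require Import complex polyrcf ring lra.

Set Implicit Arguments.
Unset Strict Implicit.
Unset Printing Implicit Defensive.

Import Order.TTheory GRing.Theory Num.Theory.
Import numFieldNormedType.Exports.

Local Open Scope classical_set_scope.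
Local Open Scope sesquilinear_scope.
Local Open Scope complex_scope.
Local Open Scope ring_scope.

(** Positivity enters only through two facts: a completely positive map sends
Hermitian matrices to Hermitian matrices, and a unital one fixes [1]. Both
descend to generators, where [1] is killed instead of fixed. So both halves of
the theorem are instances of [invariant_masa]: a linear map [S] of [M_2] that
preserves Hermitian matrices and sends [1] to a multiple of [1] has an invariant
masa.

For the proof of [invariant_masa], write a Hermitian matrix as [r + v.sigma]
with [r] a real number, [v] a real 3-vector and [sigma] the Pauli matrices. Then
[S (v.sigma)] is Hermitian, hence equal to [r(v) + (A v).sigma] for a real 3 x 3
matrix [A]. The dimension 3 is odd, so [A] has a real eigenvector [v], with
eigenvalue [l]. For [h = v.sigma] this says that [S h] lies in the span of [1]
and [h]. Since [h] is Hermitian and not scalar, this span is a masa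
([masa_pencil]).

A generator [L] inherits linear constraints from its semigroup
([generator_trace_eq0]): if the power series in [t] of a real linear functional
of [T_t a] has a constant sum for [t >= 0], its coefficient of [t], which is the
functional at [L a], vanishes. Hermitian matrices are cut out by real linear
functionals of the form [x |-> Re tr(u x)] ([hermitian_trace]), and so is the
equation [T_t 1 = 1], which gives the two properties of [L]. *)


(** * Masas spanned by a Hermitian matrix *)

Section Masa.
Variable R : realType.
Implicit Types (a b h : M2 R).

Lemma adjE n (a : 'M[R[i]]_n) i j : (a ^t*) i j = (a j i)^*.
Proof. by rewrite !mxE. Qed.

Lemma ord2P (P : 'I_2 -> Prop) : P 0 -> P 1 -> forall i, P i.
Proof.
move=> P0 P1 i; case: (unliftP 0 i) => [j ->|-> //].
by rewrite (_ : lift 0 j = 1) //; apply/val_inj; rewrite /= (ord1 j).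
Qed.

Lemma mx2P a b :
  a 0 0 = b 0 0 -> a 0 1 = b 0 1 -> a 1 0 = b 1 0 -> a 1 1 = b 1 1 -> a = b.
Proof. by move=> *; apply/matrixP; apply: ord2P; apply: ord2P. Qed.

Definition hermitian n (a : 'M[R[i]]_n) : Prop := a ^t* = a.

Lemma hermitianP n (a : 'M[R[i]]_n) :
  hermitian a <-> forall i j, a i j = (a j i)^*.
Proof.
split=> [ah i j|ah]; first by rewrite -{1}ah adjE.
by apply/matrixP => i j; rewrite adjE -ah.
Qed.

Definition pencil h : set (M2 R) := [set a | exists x y, a = x%:M + y *: h].

(** Reduces a goal to a ring identity, given the multiple of a hypothesis from
which it follows. *)
Lemma eq_lincomb (c u v x y : R[i]) : u = v -> x - y = c * (u - v) -> x = y.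
Proof. by move=> ->; rewrite subrr mulr0 => /subr0_eq. Qed.

(** The off-diagonal entries and the difference of the diagonal entries of a
2 x 2 matrix form its traceless part, as a vector; [a] and [h] commute exactly
when the cross product of their vectors vanishes. As the vector of [h] is not
zero, that of [a] is a multiple of it, the factor being read off from any
nonzero coordinate of [h]. *)
Lemma commutant_pencil h a :
  ~~ is_scalar_mx h -> a *m h = h *m a -> pencil h a.
Proof.
move=> hns /matrixP comm.
have e i j : a i 0 * h 0 j + a i 1 * h 1 j = h i 0 * a 0 j + h i 1 * a 1 j.
  have := comm i j; rewrite !mxE !big_ord_recl !big_ord0 !addr0.
  by rewrite (_ : lift ord0 ord0 = 1) //; apply/val_inj.
have e00 := e 0 0; have e01 := e 0 1; have e10 := e 1 0.
have key y : a 0 1 = y * h 0 1 -> a 1 0 = y * h 1 0 ->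
    a 0 0 - a 1 1 = y * (h 0 0 - h 1 1) -> pencil h a.
  move=> y01 y10 yd; exists (a 0 0 - y * h 0 0), y.
  apply: mx2P; rewrite !mxE /= ?mulr1n ?mulr0n ?add0r //; first by ring.
  by apply: (eq_lincomb (c := -1) yd); ring.
have [h01|h01] := eqVneq (h 0 1) 0; last first.
  have y01 : a 0 1 = a 0 1 / h 0 1 * h 0 1 by rewrite divfK.
  apply: (key _ y01); apply: (mulfI h01); rewrite [RHS]mulrCA mulrA -y01.
    by apply: (eq_lincomb (c := -1) e00); ring.
  by apply: (eq_lincomb (c := 1) e01); ring.
have [h10|h10] := eqVneq (h 1 0) 0; last first.
  have y10 : a 1 0 = a 1 0 / h 1 0 * h 1 0 by rewrite divfK.
  apply: (key _ _ y10); apply: (mulfI h10); rewrite [RHS]mulrCA mulrA -y10.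
    by apply: (eq_lincomb (c := 1) e00); ring.
  by apply: (eq_lincomb (c := -1) e10); ring.
have hd : h 0 0 - h 1 1 != 0.
  apply: contraNneq hns => /subr0_eq hd; apply/is_scalar_mxP; exists (h 0 0).
  by apply: mx2P; rewrite !mxE /= ?mulr1n ?mulr0n.
apply: (key ((a 0 0 - a 1 1) / (h 0 0 - h 1 1))); last by rewrite divfK.
- rewrite h01 mulr0; apply: (mulfI hd).
  by apply: (eq_lincomb (c := -1) e01); rewrite h01; ring.
- rewrite h10 mulr0; apply: (mulfI hd).
  by apply: (eq_lincomb (c := 1) e10); rewrite h10; ring.
Qed.

(** Cayley-Hamilton in dimension 2: this is what closes [pencil h] under
products. *)
Lemma cayley_hamilton2 h :
  h *m h = (h 0 1 * h 1 0 - h 0 0 * h 1 1)%:M + (h 0 0 + h 1 1) *: h.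
Proof.
have l : lift ord0 ord0 = 1 :> 'I_2 by apply/val_inj.
by apply: mx2P; rewrite !mxE !big_ord_recl !big_ord0 /= !l; ring.
Qed.

(** Maximality: a commutative algebra that contains [h] lies in the commutant of
[h], which [commutant_pencil] identifies. Closure under adjoints uses that [h]
is Hermitian. *)
Lemma masa_pencil h : hermitian h -> ~~ is_scalar_mx h -> masa (pencil h).
Proof.
move=> hh hns.
have com a b : pencil h a -> pencil h b -> a *m b = b *m a.
  move=> [x [y ->]] [z [w ->]].
  rewrite !mulmxDl !mulmxDr -!scalar_mxM (mulrC x z) -!scalemxAl -!scalemxAr.
  by rewrite !scalerA (mulrC y w) !mul_scalar_mx !mul_mx_scalar !scalerA
    -!addrA; congr (_ + _); rewrite addrCA (mulrC y) (mulrC w).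
have h1 : pencil h 1%:M by exists 1, 0; rewrite scale0r addr0.
split => //; last first.
  move=> D [D0 Da Dz Dm Dj Dc] CD; apply/seteqP; split => // a Da'.
  apply: commutant_pencil => //; apply: Dc => //; apply: CD.
  by exists 0, 1; rewrite scale1r raddf0 add0r.
split => //.
- by exists 0, 0; rewrite scale0r raddf0 addr0.
- move=> _ _ [x [y ->]] [z [w ->]]; exists (x + z), (y + w).
  by rewrite scalerDl raddfD /= addrACA.
- move=> t _ [x [y ->]]; exists (t * x), (t * y).
  by rewrite scalerDr scalerA scale_scalar_mx.
- move=> _ _ [x [y ->]] [z [w ->]].
  rewrite !mulmxDl !mulmxDr -!scalar_mxM -!scalemxAl -!scalemxAr.
  rewrite cayley_hamilton2 mul_scalar_mx mul_mx_scalar.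
  set d := _ - _; set t := _ + h 1 1.
  exists (x * z + y * w * d), (x * w + y * z + y * w * t).
  by apply/matrixP => i j; rewrite !mxE; ring.
- move=> _ [x [y ->]]; exists x^*, y^*.
  move/hermitianP: hh => hh; apply/matrixP => i j.
  by rewrite adjE [LHS]/= !mxE rmorphD rmorphM rmorphMn eq_sym [in RHS]hh.
Qed.

End Masa.

(** * Bloch coordinates *)

Section Bloch.
Variable R : realType.
Implicit Types (a h : M2 R) (v : 'rV[R]_3).
Local Notation Re := (@complex.Re R).
Local Notation Im := (@complex.Im R).

(** [v.sigma]: the diagonal is [(v2, - v2)] and the off-diagonal entries are
[v0 - i v1] above and [v0 + i v1] below; the exponent [j] of the sign is the
column. *)
Definition bloch v : M2 R := \matrix_(i, j)
  if i == j then (-1) ^+ i * (v 0 2)%:C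
  else (v 0 0)%:C + (-1) ^+ j * ('i * (v 0 1)%:C).

(** A left inverse of [bloch] that ignores the scalar part; it is linear over the
reals on all of [M_2], not only on Hermitian matrices, so that it can be composed
with linear maps. *)
Definition bloch_coord a : 'rV[R]_3 :=
  \row_k if k == 0 then Re (a 1 0) else if k == 1 then Im (a 1 0)
          else Re (a 0 0 - a 1 1) / 2.

Lemma bloch_linear (r : R) v w :
  bloch (r *: v + w) = r%:C *: bloch v + bloch w.
Proof.
apply/matrixP => i j; rewrite !mxE.
by case: ifP => _; rewrite !rmorphD !rmorphM; ring.
Qed.

Lemma bloch_coord_linear (r : R) a b :
  bloch_coord (r%:C *: a + b) = r *: bloch_coord a + bloch_coord b.
Proof.
have reE (x y : R[i]) : Re (r%:C * x + y) = r * Re x + Re y.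
  by case: x y => [p q] [s t] /=; ring.
have imE (x y : R[i]) : Im (r%:C * x + y) = r * Im x + Im y.
  by case: x y => [p q] [s t] /=; ring.
apply/rowP => k; rewrite !mxE; case: ifP => _ //; case: ifP => _ //.
have -> : r%:C * a 0 0 + b 0 0 - (r%:C * a 1 1 + b 1 1) =
  r%:C * (a 0 0 - a 1 1) + (b 0 0 - b 1 1) by ring.
by rewrite reE; ring.
Qed.

Lemma hermitian_bloch v : hermitian (bloch v).
Proof.
apply/hermitianP; apply: ord2P; apply: ord2P; rewrite !mxE /=; apply/eqP.
all: rewrite eq_complex /= ?expr0 ?expr1 /=; apply/andP; split; apply/eqP; ring.
Qed.

Lemma bloch_scalar_eq0 v : is_scalar_mx (bloch v) -> v = 0.
Proof.
case/is_scalar_mxP => z /matrixP e.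
have := e 0 0; have := e 1 1; have := e 1 0.
rewrite !mxE /= !mulr1n mulr0n !expr0.
case: z {e} => p q.
move=> /eqP; rewrite eq_complex /= => /andP[/eqP r0 /eqP i0].
move=> /eqP; rewrite eq_complex /= => /andP[/eqP r1 /eqP i1].
move=> /eqP; rewrite eq_complex /= => /andP[/eqP r2 /eqP i2].
apply/rowP => k; rewrite mxE.
have k3 : [|| k == 0, k == 1 | k == 2] by case: k => [[|[|[|]]]].
case/or3P: k3 => /eqP ->; lra.
Qed.

Lemma hermitian_decomp a : hermitian a ->
  exists r : R, a = r%:C%:M + bloch (bloch_coord a).
Proof.
move/hermitianP => ah; exists (Re (a 0 0 + a 1 1) / 2).
move: (ah 0 0) (ah 1 1) (ah 0 1).
case e00: (a 0 0) => [p p']; case e11: (a 1 1) => [q q'].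
case e01: (a 0 1) => [s s']; case e10: (a 1 0) => [t t'].
move=> [p0] [q0] [st st'].
apply: mx2P; rewrite !mxE /= ?e00 ?e11 ?e10 ?e01; apply/eqP.
all: rewrite eq_complex /= ?expr0 ?expr1 /=; apply/andP; split; apply/eqP.
all: lra.
Qed.

Lemma pencil_image (S : {linear M2 R -> M2 R}) h (s x y : R[i]) :
  S 1%:M = s%:M -> S h = x%:M + y *: h -> S @` pencil h `<=` pencil h.
Proof.
move=> S1 Sh _ [_ [z [w ->]] <-].
rewrite -[z]mulr1 -scale_scalar_mx linearD !linearZ S1 Sh.
exists (z * s + w * x), (w * y).
by rewrite /= scalerDr scalerA addrA !scale_scalar_mx raddfD.
Qed.

(** The matrix [A] of [v |-> bloch_coord (S (bloch v))] is real of size 3, hence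
its characteristic polynomial has odd degree and a real root. An eigenvector [v]
makes [bloch v] invariant up to a scalar matrix. *)
Lemma invariant_masa (S : {linear M2 R -> M2 R}) (s : R[i]) :
  S 1%:M = s%:M -> (forall a, hermitian a -> hermitian (S a)) ->
  exists C, masa C /\ S @` C `<=` C.
Proof.
move=> S1 Sh; pose f v := bloch_coord (S (bloch v)).
have f_lin : linear f.
  by move=> r v w; rewrite /f bloch_linear linearP bloch_coord_linear.
pose fl : {linear 'rV[R]_3 -> 'rV[R]_3} :=
  HB.pack f (GRing.isLinear.Build _ _ _ _ f f_lin).
have [|l] := @odd_poly_root _ (char_poly (lin1_mx fl)).
  (* [odd_poly_root] asks for an even size, which is 1 + the degree. *)
  by rewrite size_char_poly.
rewrite -eigenvalue_root_char => /eigenvalueP [v]; rewrite mul_rV_lin1 => fv v0.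
have [r Sv] := hermitian_decomp (Sh _ (hermitian_bloch v)).
exists (pencil (bloch v)); split.
  apply: masa_pencil; first exact: hermitian_bloch.
  by apply: contraNN v0 => /bloch_scalar_eq0 ->.
apply: (pencil_image S1 (x := r%:C) (y := l%:C)); rewrite Sv; congr (_ + _).
rewrite -[bloch_coord _]/(fl v) fv -[_ *: _]addr0 bloch_linear.
rewrite (_ : bloch 0 = 0) ?addr0 //.
by apply/matrixP => i j; rewrite !mxE !mulr0 addr0; case: ifP.
Qed.

End Bloch.

(** * Hermitian matrices, positivity and the trace form *)

Section Hermitian.
Variable R : realType.
Implicit Types (a b : M2 R).
Local Notation Re := (@complex.Re R).

Lemma trmxC_mul n (a b : 'M[R[i]]_n) : (a *m b) ^t* = b ^t* *m a ^t*.
Proof. by rewrite trmx_mul map_mxM. Qed.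

(** Amplifying by [n = 1] shows that complete positivity implies positivity. *)
Lemma cp_square (T : M2 R -> M2 R) b :
  completely_positive T -> exists c : M2 R, T (b ^t* *m b) = c ^t* *m c.
Proof.
move=> cpT; have [|c e] := @cpT 1%N (const_mx (b ^t* *m b)).
  by exists (const_mx b); apply/matrixP => i j; rewrite !mxE big_ord1 !mxE.
by exists (c 0 0); have /matrixP/(_ 0 0) := e; rewrite !mxE big_ord1 !mxE.
Qed.

(** A Hermitian matrix is a real combination of positive ones, by the
polarization [4 a = (a + 1)^2 - (a - 1)^2]. *)
Lemma cp_hermitian (T : {linear M2 R -> M2 R}) a :
  completely_positive T -> hermitian a -> hermitian (T a).
Proof.
move=> cpT ah; pose q b : M2 R := b ^t* *m b.
have qh b : hermitian (q b) by rewrite /hermitian trmxC_mul trmxCK.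
have Tq b : hermitian (T (q b)).
  by have [c ->] := cp_square b cpT; exact: qh.
have adj_shift (e : R[i]) : e^* = e -> (a + e%:M) ^t* = a + e%:M.
  move=> er; move/hermitianP: ah => ah'; apply/matrixP => i j.
  by rewrite adjE !mxE rmorphD rmorphMn /= er eq_sym [in RHS]ah'.
have -> : a = 4^-1 *: (q (a + 1%:M) - q (a + (-1)%:M)).
  rewrite /q (adj_shift 1 (rmorph1 _)) (adj_shift (-1) (rmorphN1 _)).
  apply/matrixP => i j.
  by rewrite !mulmxDl !mulmxDr !mul_scalar_mx !mul_mx_scalar !mxE; field.
apply/hermitianP => i j; rewrite linearZ linearB /= !mxE rmorphM rmorphB /=.
by rewrite -!((hermitianP _).1 (Tq _)) fmorphV rmorph_nat.
Qed.

Lemma Re_trace_adj n (a : 'M[R[i]]_n) : Re (\tr (a ^t*)) = Re (\tr a).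
Proof. by rewrite trace_map_mx mxtrace_tr /=; case: (\tr a). Qed.

(** [tr(a* a)] is the sum of the squared moduli of the entries of [a]. *)
Lemma trace_adj_mul_eq0 n (a : 'M[R[i]]_n) :
  Re (\tr (a ^t* *m a)) = 0 -> a = 0.
Proof.
move=> tr0; pose q i j := Re (a j i) ^+ 2 + complex.Im (a j i) ^+ 2.
have q0 i j : 0 <= q i j by rewrite addr_ge0 ?sqr_ge0.
have trE : \sum_i \sum_j q i j = 0.
  rewrite -[RHS]tr0 /mxtrace raddf_sum; apply: eq_bigr => i _.
  rewrite mxE raddf_sum; apply: eq_bigr => j _; rewrite adjE /q.
  by case: (a j i) => x y /=; ring.
apply/matrixP => j i; rewrite mxE; apply/eqP.
have s0 k : 0 <= \sum_l q k l by apply: sumr_ge0.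
have : \sum_l q i l == 0.
  by move/eqP: trE; rewrite psumr_eq0 // => /allP /(_ i (mem_index_enum _)).
rewrite psumr_eq0 // => /allP /(_ j (mem_index_enum _)); rewrite /=.
by rewrite paddr_eq0 ?sqr_ge0 // !sqrf_eq0 eq_complex.
Qed.

(** For the real inner product [Re tr(x* y)], the Hermitian matrices are the
orthogonal complement of the skew-Hermitian ones. In the converse direction, test
against [u = a - a*]: the hypothesis turns [Re tr(u* u)] into zero. Being Hermitian
thus becomes a family of real linear equations, the form in which the property
passes from a semigroup to its generator. *)
Lemma hermitian_trace n (a : 'M[R[i]]_n) :
  hermitian a <-> forall u, u ^t* = - u -> Re (\tr (u *m a)) = 0.
Proof.
have skew (u b : 'M[R[i]]_n) : u ^t* = - u ->
    Re (\tr (u *m b ^t*)) = - Re (\tr (u *m b)).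
  move=> us; rewrite -[in RHS]Re_trace_adj trmxC_mul us mulmxN mxtrace_mulC.
  by rewrite [in RHS]raddfN [in RHS]raddfN opprK.
split=> [ah u us|a0]; first by have := skew u a us; rewrite ah; lra.
pose y := a - a ^t*.
have ys : y ^t* = - y by rewrite /y linearB /= map_mxB trmxCK opprB.
apply/esym/subr0_eq/trace_adj_mul_eq0; rewrite -/y ys mulNmx {2}/y.
by rewrite mulmxBr !raddfN !raddfB /= skew // a0 // !(oppr0, subrr).
Qed.

End Hermitian.

(** * Differentiating the exponential series *)

(** A power series constant on [[0, 1]] has zero coefficient of [t]. Convergence at
[t = 1] bounds all coefficients by some [K], so for [t <= 1/2] the terms of degree
at least 2 add up to at most [2 K t^2]. Since the sums at [t] and at [0] agree, the
linear term satisfies [t |a_1| <= 2 K t^2], and [t] may be taken small. *)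
Lemma constant_power_series_coef1 (R : realType) (a : R^nat) (s : R) :
  (forall t, 0 <= t <= 1 -> series (fun k => a k * t ^+ k) @ \oo --> s) ->
  a 1%N = 0.
Proof.
move=> a_cvg; have [K aK] : exists K : R, forall k, `|a k| <= K.
  have c1 : cvgn (series (fun k => a k * 1 ^+ k)).
    by apply/cvg_ex; exists s; apply: a_cvg; rewrite ler01 lexx.
  have [M [_ bM]] := cvg_series_bounded c1; exists (M + 1) => k.
  by have := bM (M + 1) (ltr_pwDr ltr01 (lexx M)) k I; rewrite /= expr1n mulr1.
have K0 : 0 <= K := le_trans (normr_ge0 _) (aK 0%N).
have small t : 0 <= t <= 2^-1 -> t * `|a 1%N| <= 2 * K * t ^+ 2.
  move=> /andP[t0 t2].
  pose D n := series (fun k => a k * t ^+ k) (n + 2)%N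
            - series (fun k => a k * 0 ^+ k) (n + 2)%N - t * a 1%N.
  (* The factor [1 - t ^+ n] makes the bound inductive: the step needs
     [t ^+ n <= 2 * (t ^+ n - t ^+ n.+1)], which is [t <= 1/2]. *)
  have bD n : `|D n| <= 2 * K * t ^+ 2 * (1 - t ^+ n).
    elim: n => [|n IH].
      rewrite /D /series /= !big_nat_recr //= !big_geq //=.
      by rewrite [X in `|X|](_ : _ = 0) ?normr0 ?subrr ?mulr0 //; ring.
    have -> : D n.+1 = D n + a (n + 2)%N * t ^+ (n + 2)%N.
      by rewrite /D addSn !seriesSr [0 ^+ _]expr0n addn2 /=; ring.
    apply: (le_trans (ler_normD _ _)).
    rewrite normrM (ger0_norm (exprn_ge0 _ t0)).
    apply: (le_trans (lerD IH (ler_wpM2r (exprn_ge0 _ t0) (aK _)))).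
    rewrite exprD [t ^+ n.+1]exprS.
    have : 0 <= t ^+ n by apply: exprn_ge0.
    have : 0 <= K * t ^+ 2 * t ^+ n * (1 - 2 * t).
      by rewrite !mulr_ge0 ?exprn_ge0 //; lra.
    lra.
  have cD : D @ \oo --> - (t * a 1%N).
    rewrite -[X in _ --> X]add0r -(subrr s).
    apply: cvgB; last exact: cvg_cst.
    apply: cvgB.
      rewrite (cvg_shiftn 2 (series (fun k => a k * t ^+ k))); apply: a_cvg; lra.
    rewrite (cvg_shiftn 2 (series (fun k => a k * 0 ^+ k))); apply: a_cvg; lra.
  rewrite -[X in X * _](ger0_norm t0) -normrM -normrN.
  apply: (ler_cvg_to (cvg_norm cD) (cvg_cst (2 * K * t ^+ 2))).
  near=> n; apply: (le_trans (bD n)).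
  rewrite ler_piMr ?mulr_ge0 ?exprn_ge0 // gerBl; exact: exprn_ge0.
apply/eqP/negPn/negP => a1.
set p := `|a 1%N| in small; have p0 : 0 < p by rewrite normr_gt0.
have d0 : 0 < 2 * K + p by lra.
(* This value of [t] is at most 1/2, and [2 * K * t < p]. *)
have q0 : 0 < p / (2 * (2 * K + p)) by rewrite divr_gt0 // mulr_gt0.
have := small (p / (2 * (2 * K + p))).
set t := p / _ in q0 *.
have tE : t * (2 * K + p) = p / 2 by rewrite /t; field; lra.
have t2 : t <= 2^-1 by rewrite -(ler_pM2r d0) tE; lra.
move=> /(_ ltac:(lra)).
rewrite expr2 mulrCA ler_pM2l // => pl.
nra.
Unshelve. all: by end_near.
Qed.

Lemma linear_form_cvg (K : numFieldType) m n (f : {scalar 'M[K]_(m, n)})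
    (u : nat -> 'M[K]_(m, n)) M :
  u @ \oo --> M -> f (u k) @[k --> \oo] --> f M.
Proof.
have fE N : f N = \sum_(i < m) \sum_(j < n) N i j * f (delta_mx i j).
  rewrite [in LHS](matrix_sum_delta N) linear_sum; apply: eq_bigr => i _.
  by rewrite linear_sum; apply: eq_bigr => j _; rewrite linearZ.
move=> uM; rewrite fE.
under eq_fun do rewrite fE.
apply: cvg_big => [|i _]; first exact: add_continuous.
apply: cvg_big => [|j _]; first exact: add_continuous.
apply: cvgMr_tmp.
exact: (cvg_comp _ _ uM (@coord_continuous _ _ _ i j M)).
Qed.

Lemma Re_cvg (R : realType) (u : nat -> R[i]) l :
  u @ \oo --> l -> complex.Re (u k) @[k --> \oo] --> complex.Re l.
Proof.
move=> /cvgrPdist_lt ul; apply/cvgrPdist_lt => e e0.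
have e0' : 0 < e%:C by rewrite ltcR.
have := ul _ e0'; apply: filterS => k.
rewrite -ltcR; apply: le_lt_trans.
rewrite -raddfB; exact: normc_ge_Re.
Qed.

(** [Re tr(w T_t a)] is the sum of a power series in [t] whose coefficient of [t]
is [Re tr(w L a)]: apply to the exponential series the continuous real linear form
[M |-> Re tr(w (a M))], where [a M] is the image of [a] under the operator with
matrix [M]. *)
Lemma generator_trace_eq0 (R : realType) (T : R -> {linear M2 R -> M2 R})
    (L : {linear M2 R -> M2 R}) (w a : M2 R) (s : R) :
  is_exp_semigroup T L ->
  (forall t, 0 <= t -> complex.Re (\tr (w *m T t a)) = s) ->
  complex.Re (\tr (w *m L a)) = 0.
Proof.
move=> expT Ts.
pose f (M : 'M[R[i]]_(2 * 2)) := \tr (w *m vec_mx (mxvec a *m M)).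
have f_lin : scalar f.
  by move=> z M N; rewrite /f mulmxDr -scalemxAr !linearP.
pose fl : {scalar 'M[R[i]]_(2 * 2)} :=
  HB.pack f (GRing.isLinear.Build _ _ _ _ f f_lin).
have fE (S : {linear M2 R -> M2 R}) : \tr (w *m S a) = fl (lin_mx S).
  by rewrite /= /f mx_vec_lin.
rewrite fE; pose c k := complex.Re (fl (lin_mx L ^+ k)) / k`!%:R.
suff : c 1%N = 0 by rewrite /c expr1 divr1.
apply: (constant_power_series_coef1 (s := s)) => t /andP[t0 _].
have := Re_cvg (linear_form_cvg (f := fl) (expT t t0)).
rewrite -fE Ts // => f_cvg.
rewrite (_ : series _ = fun n => complex.Re (fl
  (series (fun k => (exp_coeff t k)%:C *: lin_mx L ^+ k) n))); first exact: f_cvg.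
apply/funext => n; rewrite -![series _ n]/(\sum_(0 <= _ < n) _) (linear_sum fl).
rewrite (raddf_sum (@complex.Re R)); apply: eq_bigr => k _.
rewrite (scalarZ fl) /c /exp_coeff.
case: (fl _) => x y /=; ring.
Qed.

Lemma generator_hermitian (R : realType) (L : {linear M2 R -> M2 R}) :
  markov_generator L -> forall a, hermitian a -> hermitian (L a).
Proof.
move=> [T [T_ucp _ _ _ expT]] a ah; apply/hermitian_trace => u us.
apply: (generator_trace_eq0 expT) => t t0; apply: (hermitian_trace _).1 us.
exact: cp_hermitian (T_ucp t t0).2 ah.
Qed.

(** [Re tr(w T_t 1)] does not depend on [t], so [Re tr(w (L 1)) = 0] for every
[w]; choose [w = (L 1)*]. *)
Lemma generator1 (R : realType) (L : {linear M2 R -> M2 R}) :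
  markov_generator L -> L 1%:M = 0.
Proof.
move=> [T [T_ucp _ _ _ expT]]; apply: trace_adj_mul_eq0.
by apply: (generator_trace_eq0 expT) => t t0; rewrite (T_ucp t t0).1.
Qed.

Theorem theorem2p4 (R : realType) :
  (forall T : {linear M2 R -> M2 R}, ucp T ->
     exists C : set (M2 R), masa C /\ T @` C `<=` C) /\
  (forall L : {linear M2 R -> M2 R}, markov_generator L ->
     exists C : set (M2 R), masa C /\ L @` C `<=` C).
Proof.
split=> [T [T1 cpT]|L Lgen].
  by apply: (invariant_masa T1) => a; exact: cp_hermitian.
apply: (@invariant_masa _ _ 0); last exact: generator_hermitian.
by rewrite raddf0; exact: generator1.
Qed.
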